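(* The forgetful functor $\Phi:\mathsf{Quad}\to\mathsf{Nil}(2)$, which sends a quadratic module $(\omega,\delta,\partial)$ with $C\otimes C\xrightarrow{\omega}L\xrightarrow{\delta}M\xrightarrow{\partial}N$ to its base nil(2)-module $(\partial:M\to N)$ and a morphism $(l,m,n)$ to $(m,n)$, is a cofibration of categories.
   Context: All group actions are right actions, and groups are written multiplicatively; $[a,b]=a^{-1}b^{-1}ab$. A pre-crossed module is a group homomorphism $\partial:M\to N$ with an action of $N$ on $M$ by automorphisms, written $m^n$, such that $\partial(m^n)=n^{-1}\partial(m)n$. The Peiffer commutator of $x,y\in M$ is $\langle x,y\rangle=x^{-1}y^{-1}x\,y^{\partial x}$. A nil(2)-module is a pre-crossed module with $P_3(\partial)=1$, where $P_3(\partial)$ is the subgroup of $M$ generated by the Peiffer commutators of length 3 (iterated Peiffer commutators $\langle\langle x_1,x_2\rangle,x_3\rangle$ and $\langle x_1,\langle x_2,x_3\rangle\rangle$, $x_i\in M$). A morphism of nil(2)-modules $(m,n):(\partial:M\to N)\to(\partial':M'\to N')$ is a pair of group homomorphisms $m:M\to M'$, $n:N\to N'$ with $n\partial=\partial'm$ and $m(x^{g})=m(x)^{n(g)}$ for all $x\in M$, $g\in N$. This defines the category $\mathsf{Nil}(2)$. For a nil(2)-module $\partial:M\to N$, let $M^{cr}$ be the quotient of $M$ by the normal subgroup generated by all Peiffer commutators, let $C=(M^{cr})^{ab}$ be its abelianization, and let $q:M\to C$, $x\mapsto q(x)=\{x\}$, be the projection. The group $C\otimes C$ (tensor product of abelian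 groups) carries the diagonal $N$-action, and $w:C\otimes C\to M$ is the homomorphism $w(\{x\}\otimes\{y\})=\langle x,y\rangle$. A quadratic module $(\omega,\delta,\partial)$ consists of a nil(2)-module $\partial:M\to N$, a group $L$ with an action of $N$, and $N$-equivariant homomorphisms $\omega:C\otimes C\to L$, $\delta:L\to M$ such that for all $a,b\in L$, $x,y\in M$: (QM1) $\partial\delta=1$; (QM2) $\delta\omega(\{x\}\otimes\{y\})=w(\{x\}\otimes\{y\})=\langle x,y\rangle$; (QM3) $\omega\big((\{\delta a\}\otimes\{x\})(\{x\}\otimes\{\delta a\})\big)=a^{-1}a^{\partial x}$, where the product is taken in $C\otimes C$; (QM4) $\omega(\{\delta a\}\otimes\{\delta b\})=[a,b]$. A morphism $(l,m,n):(\omega,\delta,\partial)\to(\omega',\delta',\partial')$ consists of a morphism $(m,n)$ of the underlying pre-crossed modules, inducing $\varphi_*:C\to C'$, and an $n$-equivariant homomorphism $l:L\to L'$ with $l\omega=\omega'(\varphi_*\otimes\varphi_* )$ and $\delta'l=m\delta$. This defines the category $\mathsf{Quad}$. Let $\Phi:\mathsf X\to\mathsf B$ be a functor. A morphism $\psi:Z\to Y$ in $\mathsf X$ over $\upsilon=\Phi(\psi):K\to J$ is cocartesian if for all $u:J\to I$ in $\mathsf B$ and $\theta:Z\to X$ with $\Phi(\theta)=u\upsilon$ there is a unique $\varphi:Y\to X$ with $\Phi(\varphi)=u$ and $\theta=\varphi\psi$. The functor $\Phi$ is a cofibration (is cofibred) if for every $\upsilon:K\to J$ in $\mathsf B$ and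 every object $Z$ with $\Phi(Z)=K$ there is a cocartesian morphism $\psi:Z\to Z'$ over $\upsilon$. *)

(* Defs.v *)
(* Arbitrary, possibly infinite, groups are [groupType]s.                     *)
(* A [groupType] carries a choice structure; with the classical axioms of     *)
(* [boolp] every type has one, so this is no restriction.                     *)
From HB Require Import structures.
From mathcomp Require Import all_boot.
From mathcomp Require Import boolp.

Set Implicit Arguments.
Unset Strict Implicit.
Unset Printing Implicit Defensive.

Local Open Scope group_scope.
Local Open Scope quotient_scope.

Record category := Category {
  obj :> Type;
  hom : obj -> obj -> Type;
  idm : forall X, hom X X;
  compm : forall X Y Z, hom Y Z -> hom X Y -> hom X Z;
  comp1m : forall X Y (f : hom X Y), compm (idm Y) f = f;
  compm1 : forall X Y (f : hom X Y), compm f (idm X) = f;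
  compA : forall X Y Z T (h : hom Z T) (g : hom Y Z) (f : hom X Y),
    compm h (compm g f) = compm (compm h g) f
}.
Arguments hom {c} X Y.
Arguments idm {c} X.
Arguments compm {c X Y Z} g f.

Record functor (X B : category) := Functor {
  fobj :> X -> B;
  fmap : forall Z Y : X, hom Z Y -> hom (fobj Z) (fobj Y);
  fmap1 : forall Z : X, fmap (idm Z) = idm (fobj Z);
  fmapM : forall (Z Y W : X) (g : hom Y W) (f : hom Z Y),
    fmap (compm g f) = compm (fmap g) (fmap f)
}.
Arguments fmap {X B} _ {Z Y} _.

(* A morphism [u : J -> I] with [Phi theta = u \o Phi psi] necessarily has    *)
(* [J = Phi Y] and [I = Phi W], so both equalities are built in.              *)
Definition cocartesian (X B : category) (Phi : functor X B) (Z Y : X)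
    (psi : hom Z Y) : Prop :=
  forall (W : X) (u : hom (Phi Y) (Phi W)) (theta : hom Z W),
    fmap Phi theta = compm u (fmap Phi psi) ->
    exists! phi : hom Y W, fmap Phi phi = u /\ theta = compm phi psi.

Definition hom_cast (B : category) (K K' J J' : B) (eK : K = K') (eJ : J = J')
    (f : hom K J) : hom K' J' :=
  match eK in _ = K0, eJ in _ = J0 return hom K0 J0 with
  | erefl, erefl => f
  end.

Definition is_over (X B : category) (Phi : functor X B) (Z Y : X)
    (psi : hom Z Y) (K J : B) (v : hom K J) : Prop :=
  exists (eK : Phi Z = K) (eJ : Phi Y = J), hom_cast eK eJ (fmap Phi psi) = v.

Definition cofibration (X B : category) (Phi : functor X B) : Prop :=
  forall (K J : B) (v : hom K J) (Z : X), Phi Z = K ->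
    exists (Z' : X) (psi : hom Z Z'), is_over Phi psi v /\ cocartesian Phi psi.

Inductive generated (G : groupType) (S : G -> Prop) : G -> Prop :=
| generated_in x : S x -> generated S x
| generated1 : generated S 1
| generatedM x y : generated S x -> generated S y -> generated S (x * y)
| generatedV x : generated S x -> generated S x^-1.

Inductive normal_closure (G : groupType) (S : G -> Prop) : G -> Prop :=
| nclosure_in x : S x -> normal_closure S x
| nclosure1 : normal_closure S 1
| nclosureM x y :
    normal_closure S x -> normal_closure S y -> normal_closure S (x * y)
| nclosureV x : normal_closure S x -> normal_closure S x^-1
| nclosureJ x y : normal_closure S x -> normal_closure S (x ^ y).

Section NormalQuotient.
Variables (G : groupType) (S : G -> Prop).
Local Notation N := (normal_closure S).

Definition nquot_rel : rel G := fun x y => `[< N (x^-1 * y) >].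

Lemma nquot_equiv : equiv_class_of nquot_rel.
Proof.
split=> [x|x y|y x z].
- by apply/asboolP; rewrite mulVg; apply: nclosure1.
- apply: asbool_equiv_eq; split=> /nclosureV; by rewrite invgM invgK.
- move=> /asboolP xy /asboolP yz; apply/asboolP.
  by have := nclosureM xy yz; rewrite -mulgA mulVKg.
Qed.

Canonical nquot_eqrel := EquivRelPack nquot_equiv.

(* [nquot S] is G modulo the normal subgroup generated by S. *)
Definition nquot : Type := {eq_quot nquot_eqrel}.
HB.instance Definition _ := Choice.on nquot.
HB.instance Definition _ := EqQuotient.on nquot.

Definition nquot_pi (x : G) : nquot := \pi_nquot x.

Lemma nquotP x y : nquot_pi x = nquot_pi y <-> N (x^-1 * y).
Proof.
split=> [/eqquotP|h]; first by move/asboolP.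
by apply/eqquotP/asboolP.
Qed.

Lemma nquot_reprK (c : nquot) : nquot_pi (repr c) = c.
Proof. exact: reprK. Qed.

Definition nquot_one : nquot := nquot_pi 1.
Definition nquot_mul (c d : nquot) : nquot := nquot_pi (repr c * repr d).
Definition nquot_inv (c : nquot) : nquot := nquot_pi (repr c)^-1.

Lemma nquot_piM x y : nquot_pi (x * y) = nquot_mul (nquot_pi x) (nquot_pi y).
Proof.
rewrite /nquot_mul; apply/nquotP.
have /nquotP hx := esym (nquot_reprK (nquot_pi x)).
have /nquotP hy := esym (nquot_reprK (nquot_pi y)).
set x' := repr _ in hx *; set y' := repr _ in hy *.
have := nclosureM (nclosureJ y hx) hy.
by rewrite /conjg invgM -!mulgA !mulVKg.
Qed.

Lemma nquot_piV x : nquot_pi x^-1 = nquot_inv (nquot_pi x).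
Proof.
rewrite /nquot_inv; apply/nquotP; rewrite invgK.
have /nquotP hx := nquot_reprK (nquot_pi x).
by have := nclosureJ (repr (nquot_pi x))^-1 hx; rewrite /conjg invgK -!mulgA mulVKg.
Qed.

Lemma nquot_ind (P : nquot -> Prop) : (forall x, P (nquot_pi x)) -> forall c, P c.
Proof. by move=> h c; rewrite -(nquot_reprK c). Qed.

Fact nquot_mulA : associative nquot_mul.
Proof.
elim/nquot_ind=> x; elim/nquot_ind=> y; elim/nquot_ind=> z.
by rewrite -!nquot_piM mulgA.
Qed.
Fact nquot_mul1 : left_id nquot_one nquot_mul.
Proof. by elim/nquot_ind=> x; rewrite -nquot_piM mul1g. Qed.
Fact nquot_mulr1 : right_id nquot_one nquot_mul.
Proof. by elim/nquot_ind=> x; rewrite -nquot_piM mulg1. Qed.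
Fact nquot_mulV : left_inverse nquot_one nquot_inv nquot_mul.
Proof. by elim/nquot_ind=> x; rewrite -nquot_piV -nquot_piM mulVg. Qed.
Fact nquot_mulrV : right_inverse nquot_one nquot_inv nquot_mul.
Proof. by elim/nquot_ind=> x; rewrite -nquot_piV -nquot_piM mulgV. Qed.

HB.instance Definition _ := isGroup.Build nquot
  nquot_mulA nquot_mul1 nquot_mulr1 nquot_mulV nquot_mulrV.

Lemma nquot_morph : {morph nquot_pi : x y / x * y}.
Proof. exact: nquot_piM. Qed.

(* The map induced by f on the quotient, computed on representatives: it is   *)
(* meaningful when f is a homomorphism that kills S, see [nquot_liftE].       *)
Definition nquot_lift (T : Type) (f : G -> T) (c : nquot) : T := f (repr c).

End NormalQuotient.
Arguments nquot_pi {G} S x.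

Lemma morph1 (G H : groupType) (f : G -> H) :
  {morph f : x y / x * y} -> f 1 = 1.
Proof. by move=> fM; apply: (mulIg (f 1)); rewrite -fM !mul1g. Qed.

Lemma morphV (G H : groupType) (f : G -> H) :
  {morph f : x y / x * y} -> {morph f : x / x^-1}.
Proof.
by move=> fM x; apply: (mulIg (f x)); rewrite -fM !mulVg morph1.
Qed.

Lemma nquot_liftE (G H : groupType) (S : G -> Prop) (f : G -> H) :
  {morph f : x y / x * y} -> (forall x, S x -> f x = 1) ->
  forall x, nquot_lift f (nquot_pi S x) = f x.
Proof.
move=> fM fS x; have fV := morphV fM.
have fN y : normal_closure S y -> f y = 1.
  elim=> [||y1 y2 _ h1 _ h2|y1 _ h|y1 y2 _ h].
  - exact: fS.
  - exact: morph1.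
  - by rewrite fM h1 h2 mulg1.
  - by rewrite fV h invg1.
  - by rewrite !fM fV h mul1g mulVg.
have /nquotP/fN := nquot_reprK (nquot_pi S x).
by rewrite fM fV => /mulg1_eq; rewrite invgK.
Qed.

Lemma nquot_lift_morph (G H : groupType) (S : G -> Prop) (f : G -> H) :
  {morph f : x y / x * y} -> (forall x, S x -> f x = 1) ->
  {morph (nquot_lift f : nquot S -> H) : x y / x * y}.
Proof.
move=> fM fS; elim/nquot_ind=> x; elim/nquot_ind=> y.
by rewrite -nquot_morph !nquot_liftE.
Qed.

Definition commutators (G : groupType) (z : G) : Prop :=
  exists x y : G, z = [~ x, y].

Definition abelianization (G : groupType) : groupType :=
  nquot (@commutators G).

Lemma abelianizationC (G : groupType) (c d : abelianization G) : c * d = d * c.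
Proof.
elim/nquot_ind: c => x; elim/nquot_ind: d => y.
rewrite -!nquot_morph; apply/esym/nquotP/nclosure_in.
by exists x, y; rewrite invgM /commg /conjg -!mulgA.
Qed.

(* Formal group expressions in the symbols a (x) b. *)
Inductive texp (A B : Type) : Type :=
| Tgen (a : A) (b : B)
| Tone
| Tmul (s t : texp A B)
| Tinv (s : texp A B).
Arguments Tone {A B}.

HB.instance Definition _ (A B : Type) := gen_eqMixin (texp A B).
HB.instance Definition _ (A B : Type) := gen_choiceMixin (texp A B).

(* The congruence generated by the axioms of abelian groups and the           *)
(* bilinearity relations.                                                     *)
Inductive tcong (A B : groupType) : texp A B -> texp A B -> Prop :=
| tc_refl s : tcong s s
| tc_sym s t : tcong s t -> tcong t s
| tc_trans s t u : tcong s t -> tcong t u -> tcong s u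
| tc_mul s s' t t' : tcong s s' -> tcong t t' -> tcong (Tmul s t) (Tmul s' t')
| tc_inv s s' : tcong s s' -> tcong (Tinv s) (Tinv s')
| tc_mulA s t u : tcong (Tmul s (Tmul t u)) (Tmul (Tmul s t) u)
| tc_mul1 s : tcong (Tmul Tone s) s
| tc_mulV s : tcong (Tmul (Tinv s) s) Tone
| tc_mulC s t : tcong (Tmul s t) (Tmul t s)
| tc_linl a a' b : tcong (Tgen (a * a') b) (Tmul (Tgen a b) (Tgen a' b))
| tc_linr a b b' : tcong (Tgen a (b * b')) (Tmul (Tgen a b) (Tgen a b')).

Fixpoint teval (A B : Type) (G : groupType) (h : A -> B -> G) (s : texp A B) : G :=
  match s with
  | Tgen a b => h a b
  | Tone => 1
  | Tmul s t => teval h s * teval h t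
  | Tinv s => (teval h s)^-1
  end.

Section Tensor.
Variables A B : groupType.

Definition tensor_rel : rel (texp A B) := fun s t => `[< tcong s t >].

Lemma tensor_equiv : equiv_class_of tensor_rel.
Proof.
split=> [s|s t|t s u].
- by apply/asboolP; apply: tc_refl.
- by apply: asbool_equiv_eq; split; apply: tc_sym.
- by move=> /asboolP st /asboolP tu; apply/asboolP; apply: tc_trans st tu.
Qed.

Canonical tensor_eqrel := EquivRelPack tensor_equiv.

(* The tensor product of abelian groups, written multiplicatively; only meant *)
(* for abelian A and B. *)
Definition tensor : Type := {eq_quot tensor_eqrel}.
HB.instance Definition _ := Choice.on tensor.
HB.instance Definition _ := EqQuotient.on tensor.

Definition tensor_pi (s : texp A B) : tensor := \pi_tensor s.

Lemma tensorP s t : tensor_pi s = tensor_pi t <-> tcong s t.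
Proof.
split=> [/eqquotP|h]; first by move/asboolP.
by apply/eqquotP/asboolP.
Qed.

Lemma tensor_reprK (c : tensor) : tensor_pi (repr c) = c.
Proof. exact: reprK. Qed.

Definition tensor_one : tensor := tensor_pi Tone.
Definition tensor_mul (c d : tensor) : tensor := tensor_pi (Tmul (repr c) (repr d)).
Definition tensor_inv (c : tensor) : tensor := tensor_pi (Tinv (repr c)).

Lemma tensor_piM s t : tensor_pi (Tmul s t) = tensor_mul (tensor_pi s) (tensor_pi t).
Proof. by apply/tensorP/tc_mul; apply/tensorP; rewrite tensor_reprK. Qed.

Lemma tensor_piV s : tensor_pi (Tinv s) = tensor_inv (tensor_pi s).
Proof. by apply/tensorP/tc_inv; apply/tensorP; rewrite tensor_reprK. Qed.

Lemma tensor_pi_ind (P : tensor -> Prop) :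
  (forall s, P (tensor_pi s)) -> forall c, P c.
Proof. by move=> h c; rewrite -(tensor_reprK c). Qed.

Fact tensor_mulA : associative tensor_mul.
Proof.
elim/tensor_pi_ind=> s; elim/tensor_pi_ind=> t; elim/tensor_pi_ind=> u.
by rewrite -!tensor_piM; apply/tensorP/tc_mulA.
Qed.
Fact tensor_mulC : commutative tensor_mul.
Proof.
elim/tensor_pi_ind=> s; elim/tensor_pi_ind=> t.
by rewrite -!tensor_piM; apply/tensorP/tc_mulC.
Qed.
Fact tensor_mul1 : left_id tensor_one tensor_mul.
Proof.
by elim/tensor_pi_ind=> s; rewrite -tensor_piM; apply/tensorP/tc_mul1.
Qed.
Fact tensor_mulr1 : right_id tensor_one tensor_mul.
Proof. by move=> c; rewrite tensor_mulC tensor_mul1. Qed.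
Fact tensor_mulV : left_inverse tensor_one tensor_inv tensor_mul.
Proof.
elim/tensor_pi_ind=> s; rewrite -tensor_piV -tensor_piM.
by apply/tensorP/tc_mulV.
Qed.
Fact tensor_mulrV : right_inverse tensor_one tensor_inv tensor_mul.
Proof. by move=> c; rewrite tensor_mulC tensor_mulV. Qed.

HB.instance Definition _ := isGroup.Build tensor
  tensor_mulA tensor_mul1 tensor_mulr1 tensor_mulV tensor_mulrV.

Definition tens (a : A) (b : B) : tensor := tensor_pi (Tgen a b).

Lemma tensMl a a' b : tens (a * a') b = tens a b * tens a' b.
Proof. by rewrite -[RHS]tensor_piM; apply/tensorP/tc_linl. Qed.

Lemma tensMr a b b' : tens a (b * b') = tens a b * tens a b'.
Proof. by rewrite -[RHS]tensor_piM; apply/tensorP/tc_linr. Qed.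

Lemma tensorC (c d : tensor) : c * d = d * c.
Proof. exact: tensor_mulC. Qed.

Lemma tensor_ind (P : tensor -> Prop) :
  (forall a b, P (tens a b)) -> P 1 ->
  (forall c d, P c -> P d -> P (c * d)) -> (forall c, P c -> P c^-1) ->
  forall c, P c.
Proof.
move=> Pg P1 PM PV; elim/tensor_pi_ind; elim=> [a b||s hs t ht|s hs].
- exact: Pg.
- exact: P1.
- by rewrite tensor_piM; apply: PM.
- by rewrite tensor_piV; apply: PV.
Qed.

(* The homomorphism induced by h when h is bilinear with commuting values;    *)
(* see [tensor_liftE].                                                        *)
Definition tensor_lift (G : groupType) (h : A -> B -> G) (c : tensor) : G :=
  teval h (repr c).

Section Lift.
Variables (G : groupType) (h : A -> B -> G).
Hypothesis hMl : forall a a' b, h (a * a') b = h a b * h a' b.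
Hypothesis hMr : forall a b b', h a (b * b') = h a b * h a b'.
Hypothesis hC : forall a b a' b', commute (h a b) (h a' b').

Lemma teval_commute s t : commute (teval h s) (teval h t).
Proof.
have aux a b u : commute (h a b) (teval h u).
  elim: u => [a' b'||u hu v hv|u hu] /=.
  - exact: hC.
  - exact: commute1.
  - exact: commuteM.
  - exact: commuteV.
elim: s => [a b||u hu v hv|u hu] /=.
- exact: aux.
- exact/commute_sym/commute1.
- by apply/commute_sym/commuteM; apply: commute_sym.
- by apply/commute_sym/commuteV; apply: commute_sym.
Qed.

Lemma tensor_lift_pi s : tensor_lift h (tensor_pi s) = teval h s.
Proof.
have aux u v : tcong u v -> teval h u = teval h v.
  elim=> {u v} //=.
  - by move=> s1 t u _ -> _ ->.
  - by move=> s1 s' t t' _ -> _ ->.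
  - by move=> s1 s' _ ->.
  - by move=> s1 t u; rewrite mulgA.
  - by move=> s1; rewrite mul1g.
  - by move=> s1; rewrite mulVg.
  - by move=> s1 t; apply: teval_commute.
by apply: aux; apply/tensorP; rewrite tensor_reprK.
Qed.

Lemma tensor_liftE a b : tensor_lift h (tens a b) = h a b.
Proof. exact: tensor_lift_pi. Qed.

Lemma tensor_lift_morph : {morph tensor_lift h : c d / c * d}.
Proof.
elim/tensor_pi_ind=> s; elim/tensor_pi_ind=> t.
by rewrite -[X in tensor_lift h X]tensor_piM !tensor_lift_pi.
Qed.

End Lift.
End Tensor.

Definition tensor_map (A B A' B' : groupType) (f : A -> A') (g : B -> B') :
    tensor A B -> tensor A' B' :=
  tensor_lift (fun a b => tens (f a) (g b)).

Section TensorMap.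
Variables (A B A' B' : groupType) (f : A -> A') (g : B -> B').
Hypotheses (fM : {morph f : x y / x * y}) (gM : {morph g : x y / x * y}).

Lemma tensor_mapE a b : tensor_map f g (tens a b) = tens (f a) (g b).
Proof.
apply: (tensor_liftE (h := fun a b => tens (f a) (g b))) => *.
- by rewrite fM tensMl.
- by rewrite gM tensMr.
- exact: tensorC.
Qed.

Lemma tensor_map_morph : {morph tensor_map f g : c d / c * d}.
Proof.
apply: (tensor_lift_morph (h := fun a b => tens (f a) (g b))) => *.
- by rewrite fM tensMl.
- by rewrite gM tensMr.
- exact: tensorC.
Qed.

End TensorMap.

Lemma tensor_hom_ext (A B G : groupType) (f g : tensor A B -> G) :
  {morph f : c d / c * d} -> {morph g : c d / c * d} ->
  (forall a b, f (tens a b) = g (tens a b)) -> f =1 g.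
Proof.
move=> fM gM e; elim/tensor_ind=> [//||c d hc hd|c hc].
- by rewrite !morph1.
- by rewrite fM gM hc hd.
- by rewrite !morphV // hc.
Qed.

(* A right action by automorphisms; [act x g] is x^g. *)
Record group_action (M N : groupType) (act : M -> N -> M) : Prop := GroupAction {
  gact1 : forall x, act x 1 = x;
  gactM : forall x g h, act x (g * h) = act (act x g) h;
  gact_morph : forall g, {morph act^~ g : x y / x * y}
}.

Record preXMod := PreXMod {
  ptop : groupType;
  pbase : groupType;
  bd : ptop -> pbase;
  pact : ptop -> pbase -> ptop;
  bd_morph : {morph bd : x y / x * y};
  pactP : group_action pact;
  bd_act : forall x n, bd (pact x n) = n^-1 * bd x * n
}.
Arguments bd {p} x.
Arguments pact {p} x n.

Definition peiffer (P : preXMod) (x y : ptop P) : ptop P :=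
  x^-1 * y^-1 * x * pact y (bd x).

Definition peiffer3 (P : preXMod) (z : ptop P) : Prop :=
  exists x1 x2 x3 : ptop P,
    z = peiffer (peiffer x1 x2) x3 \/ z = peiffer x1 (peiffer x2 x3).

Definition P3 (P : preXMod) : ptop P -> Prop := generated (@peiffer3 P).

Record nil2Module := Nil2Module {
  pxm :> preXMod;
  nil2P : forall x : ptop pxm, P3 x -> x = 1
}.

Record pxm_hom (P Q : preXMod) := PxmHom {
  mtop : ptop P -> ptop Q;
  mbase : pbase P -> pbase Q;
  mtop_morph : {morph mtop : x y / x * y};
  mbase_morph : {morph mbase : x y / x * y};
  mhom_bd : forall x, mbase (bd x) = bd (mtop x);
  mhom_act : forall x g, mtop (pact x g) = pact (mtop x) (mbase g)
}.

Lemma pxm_hom_eq (P Q : preXMod) (f g : pxm_hom P Q) :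
  mtop f = mtop g -> mbase f = mbase g -> f = g.
Proof.
case: f g => m n a b c d [m' n' a' b' c' d'] /= em en.
by case: _ / em en a' b' c' d' => en; case: _ / en => *; f_equal;
  apply: Prop_irrelevance.
Qed.

Definition pxm_id (P : preXMod) : pxm_hom P P.
Proof. by exists id id. Defined.

Definition pxm_comp (P Q R : preXMod) (g : pxm_hom Q R) (f : pxm_hom P Q) :
  pxm_hom P R.
Proof.
exists (mtop g \o mtop f) (mbase g \o mbase f) => /=.
- by move=> x y /=; rewrite !mtop_morph.
- by move=> x y /=; rewrite !mbase_morph.
- by move=> x; rewrite !mhom_bd.
- by move=> x y; rewrite !mhom_act.
Defined.

Definition Nil2 : category.
Proof.
exists nil2Module (fun P Q : nil2Module => pxm_hom P Q)
  (fun P : nil2Module => pxm_id P)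
  (fun (P Q R : nil2Module) g f => pxm_comp g f) => *; exact: pxm_hom_eq.
Defined.

Definition peiffers (P : preXMod) (z : ptop P) : Prop :=
  exists x y : ptop P, z = peiffer x y.

Definition Mcr (P : preXMod) : groupType := nquot (@peiffers P).

Definition Cgrp (P : preXMod) : groupType := abelianization (Mcr P).

Definition qC (P : preXMod) (x : ptop P) : Cgrp P :=
  nquot_pi (@commutators (Mcr P)) (nquot_pi (@peiffers P) x).

Lemma qC_morph (P : preXMod) : {morph @qC P : x y / x * y}.
Proof. by move=> x y; rewrite /qC !nquot_morph. Qed.

Lemma qC_ind (P : preXMod) (K : Cgrp P -> Prop) :
  (forall x, K (qC x)) -> forall c, K c.
Proof. by move=> h; elim/nquot_ind; elim/nquot_ind. Qed.

Lemma qC_peiffer (P : preXMod) (x y : ptop P) : qC (peiffer x y) = 1.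
Proof.
rewrite /qC (_ : nquot_pi (@peiffers P) (peiffer x y) = 1).
  exact/morph1/nquot_morph.
apply/esym/nquotP; rewrite invg1 mul1g; apply: nclosure_in.
by exists x, y.
Qed.

(* The map C -> C' induced by a homomorphism m : M -> M' that preserves       *)
(* Peiffer commutators, with {x} |-> {m x}; see [Cmap_q].                     *)
Definition Cmap (P Q : preXMod) (m : ptop P -> ptop Q) : Cgrp P -> Cgrp Q :=
  nquot_lift (nquot_lift (fun x => qC (m x))).

Section Cmap.
Variables (P Q : preXMod) (m : ptop P -> ptop Q).
Hypothesis mM : {morph m : x y / x * y}.
Hypothesis mP : {morph m : x y / peiffer x y}.

Let qm_morph : {morph (fun x => qC (m x)) : x y / x * y}.
Proof. by move=> x y; rewrite mM qC_morph. Qed.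

Let qm_peiffer z : peiffers z -> qC (m z) = 1.
Proof. by case=> x [y ->]; rewrite mP qC_peiffer. Qed.

Let qm_lift_comm (z : Mcr P) :
  commutators z -> nquot_lift (fun x => qC (m x)) z = 1.
Proof.
case=> x [y ->]; have liftM := nquot_lift_morph qm_morph qm_peiffer.
by rewrite !liftM !(morphV liftM); apply/eqP/commgP/abelianizationC.
Qed.

Lemma Cmap_q x : Cmap m (qC x) = qC (m x).
Proof.
rewrite /Cmap /qC nquot_liftE ?nquot_liftE //.
exact: nquot_lift_morph.
Qed.

Lemma Cmap_morph : {morph Cmap m : c d / c * d}.
Proof.
exact: (nquot_lift_morph (nquot_lift_morph qm_morph qm_peiffer) qm_lift_comm).
Qed.

End Cmap.

Lemma mtop_peiffer (P Q : preXMod) (f : pxm_hom P Q) :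
  {morph mtop f : x y / peiffer x y}.
Proof.
move=> x y; have fM := mtop_morph f.
by rewrite /peiffer !fM !(morphV fM) mhom_act mhom_bd.
Qed.

Lemma pact_peiffer (P : preXMod) (n : pbase P) :
  {morph (fun x : ptop P => pact x n) : x y / peiffer x y}.
Proof.
move=> x y; have aM := gact_morph (pactP P) n.
rewrite /peiffer !aM !(morphV aM) bd_act; congr (_ * _).
by rewrite -!(gactM (pactP P)) !mulgA mulgV mul1g.
Qed.

Definition Cact (P : preXMod) (c : Cgrp P) (n : pbase P) : Cgrp P :=
  Cmap (fun x => pact x n) c.

(* C (x) C *)
Definition CC (P : preXMod) : groupType := tensor (Cgrp P) (Cgrp P).

Definition CCact (P : preXMod) (t : CC P) (n : pbase P) : CC P :=
  tensor_map (fun c => Cact c n) (fun c => Cact c n) t.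

Lemma CCact_tens (P : preXMod) (x y : ptop P) (n : pbase P) :
  CCact (tens (qC x) (qC y)) n = tens (qC (pact x n)) (qC (pact y n)).
Proof.
have aM := gact_morph (pactP P) n.
have aP := @pact_peiffer P n.
rewrite /CCact tensor_mapE; last 2 first.
- exact: Cmap_morph.
- exact: Cmap_morph.
by rewrite /Cact !Cmap_q.
Qed.

Definition CCmap (P Q : preXMod) (f : pxm_hom P Q) : CC P -> CC Q :=
  tensor_map (Cmap (mtop f)) (Cmap (mtop f)).

Lemma CCmap_morph (P Q : preXMod) (f : pxm_hom P Q) :
  {morph CCmap f : c d / c * d}.
Proof.
by apply: tensor_map_morph; apply: Cmap_morph (mtop_morph f) (mtop_peiffer f).
Qed.

Lemma CCmap_tens (P Q : preXMod) (f : pxm_hom P Q) (x y : ptop P) :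
  CCmap f (tens (qC x) (qC y)) = tens (qC (mtop f x)) (qC (mtop f y)).
Proof.
have fM := mtop_morph f; have fP := mtop_peiffer f.
rewrite /CCmap tensor_mapE; last 2 first.
- exact: Cmap_morph.
- exact: Cmap_morph.
by rewrite !Cmap_q.
Qed.

Lemma CC_hom_ext (P : preXMod) (G : groupType) (f g : CC P -> G) :
  {morph f : c d / c * d} -> {morph g : c d / c * d} ->
  (forall x y, f (tens (qC x) (qC y)) = g (tens (qC x) (qC y))) -> f =1 g.
Proof.
move=> fM gM e; apply: tensor_hom_ext => //.
by elim/qC_ind=> x; elim/qC_ind=> y.
Qed.

Lemma CCmap_id (P : preXMod) : CCmap (pxm_id P) =1 id.
Proof.
apply: CC_hom_ext => //; first exact: CCmap_morph.
by move=> x y; rewrite CCmap_tens.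
Qed.

Lemma CCmap_comp (P Q R : preXMod) (g : pxm_hom Q R) (f : pxm_hom P Q) :
  CCmap (pxm_comp g f) =1 CCmap g \o CCmap f.
Proof.
apply: CC_hom_ext; first exact: CCmap_morph.
  by move=> x y /=; rewrite !CCmap_morph.
by move=> x y /=; rewrite !CCmap_tens.
Qed.

Record quadModule := QuadModule {
  qbase : nil2Module;
  qL : groupType;
  qact : qL -> pbase qbase -> qL;
  omega : CC qbase -> qL;
  delta : qL -> ptop qbase;
  qactP : group_action qact;
  omega_morph : {morph omega : s t / s * t};
  delta_morph : {morph delta : a b / a * b};
  omega_act : forall t n, omega (CCact t n) = qact (omega t) n;
  delta_act : forall a n, delta (qact a n) = pact (delta a) n;
  QM1 : forall a, bd (delta a) = 1;
  QM2 : forall x y, delta (omega (tens (qC x) (qC y))) = peiffer x y;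
  QM3 : forall a x,
    omega (tens (qC (delta a)) (qC x) * tens (qC x) (qC (delta a)))
    = a^-1 * qact a (bd x);
  QM4 : forall a b, omega (tens (qC (delta a)) (qC (delta b))) = [~ a, b]
}.

Record quad_hom (X Y : quadModule) := QuadHom {
  qhom_base : pxm_hom (qbase X) (qbase Y);
  qhom_L : qL X -> qL Y;
  qhom_L_morph : {morph qhom_L : a b / a * b};
  qhom_L_act : forall a n, qhom_L (qact a n) = qact (qhom_L a) (mbase qhom_base n);
  qhom_omega : forall t, qhom_L (omega t) = omega (CCmap qhom_base t);
  qhom_delta : forall a, delta (qhom_L a) = mtop qhom_base (delta a)
}.

Lemma quad_hom_eq (X Y : quadModule) (f g : quad_hom X Y) :
  qhom_base f = qhom_base g -> qhom_L f = qhom_L g -> f = g.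
Proof.
case: f g => m l a b c d [m' l' a' b' c' d'] /= em el.
by case: _ / em b' c' d' a'; case: _ / el => *; f_equal; apply: Prop_irrelevance.
Qed.

Definition quad_id (X : quadModule) : quad_hom X X.
Proof. by exists (pxm_id (qbase X)) id => // t; rewrite CCmap_id. Defined.

Definition quad_comp (X Y Z : quadModule) (g : quad_hom Y Z) (f : quad_hom X Y) :
  quad_hom X Z.
Proof.
exists (pxm_comp (qhom_base g) (qhom_base f)) (qhom_L g \o qhom_L f) => /=.
- by move=> a b /=; rewrite !qhom_L_morph.
- by move=> a n; rewrite !qhom_L_act.
- by move=> t; rewrite !qhom_omega CCmap_comp.
- by move=> a; rewrite !qhom_delta.
Defined.

Definition Quad : category.
Proof.
exists quadModule quad_hom quad_id quad_comp => *;
  by apply: quad_hom_eq => //; apply: pxm_hom_eq.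
Defined.

Definition forget_Quad : functor Quad Nil2.
Proof.
by exists (qbase : Quad -> Nil2) (fun X Y (f : quad_hom X Y) => qhom_base f).
Defined.

(* Main.v *)
From HB Require Import structures.
From mathcomp Require Import all_boot.
From mathcomp Require Import boolp.
Require Import Defs.

Set Implicit Arguments.
Unset Strict Implicit.
Unset Printing Implicit Defensive.

Local Open Scope group_scope.
Local Open Scope quotient_scope.

(** Let [Z], with top group L, be a quadratic module over M -> N, and let
    [v] be a morphism from M -> N to another nil(2)-module Q : M' -> N'. The
    cocartesian lift of [v] exists because quadratic modules over the fixed
    base Q are the models of an equational theory, namely that of N'-groups L'
    together with [omega] on C' (x) C', [delta] to M' and the identities
    (QM1)-(QM4). So one presents L' by generators and relations: the
    generators are the elements of L and of C' (x) C', the operations are those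
    of an N'-group, and the relations say that L -> L' and C' (x) C' -> L' are
    homomorphisms, equivariant along [v] and over N' respectively, compatible
    with [omega], and that (QM3) and (QM4) hold for all elements of L'.

    (QM3) and (QM4) mention [delta], which therefore has to be defined on
    formal expressions before one divides out the relations
    ([formal_delta]). It sends a in L to [mtop v (delta a)] and {x} (x) {y} to
    the Peiffer commutator <x,y>. That the latter is well defined is where the
    nil(2) condition enters: in a nil(2)-module Peiffer commutators are
    central and bilinear, hence factor through C (x) C ([peiffer_lift]). The
    relations are compatible with [formal_delta] because (QM3) and (QM4)
    become identities about Peiffer commutators in M' once an element has
    trivial boundary in N' ([peiffer_sym], [peiffer_comm]).

    Cocartesianness is then the universal property of the presentation: for
    [theta] : Z -> W over [u \o v], the homomorphism L' -> qL W is forced on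
    generators, being [theta] on L and [omega \o CCmap u] on C' (x) C', and it
    respects the relations because W is a quadratic module ([eval_sound]). *)

(** * Peiffer commutators in nil(2)-modules *)

(** Left-associated normal form with adjacent inverses cancelled, in which
    identities between words become syntactic. *)
Definition wordE (G : groupType) :=
  (@invgM G, @invgK G, @mulgA G, @mulgK G, @mulgVK G, @mulVg G, @mulgV G,
   @mul1g G, @mulg1 G, @invg1 G).

Section Nil2Peiffer.
Variable P : nil2Module.
Implicit Types a b x y z : ptop P.

Let actM := gact_morph (pactP P).

Lemma bd_peiffer x y : bd (peiffer x y) = 1.
Proof. by rewrite /peiffer !bd_morph !(morphV (@bd_morph P)) bd_act !wordE. Qed.

Lemma peiffer_peifferl x y z : peiffer (peiffer x y) z = 1.
Proof. by apply/nil2P/generated_in; exists x, y, z; left. Qed.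

Lemma peiffer_peifferr x y z : peiffer x (peiffer y z) = 1.
Proof. by apply/nil2P/generated_in; exists x, y, z; right. Qed.

(** An element of trivial boundary acts trivially, so that [<p, z>] is the
    ordinary commutator of [p = <x, y>] and [z]; it has Peiffer length 3,
    hence is trivial. *)
Lemma peiffer_central x y z : commute (peiffer x y) z.
Proof.
have := peiffer_peifferl x y z.
rewrite {1}/peiffer bd_peiffer (gact1 (pactP P)); move: (peiffer x y) => p h.
by apply: (mulgI z^-1); apply: (mulgI p^-1); rewrite !mulgA h !wordE.
Qed.

Lemma peifferMr x y z : peiffer x (y * z) = peiffer x y * peiffer x z.
Proof.
have h := peiffer_central x y (x^-1 * z^-1 * x).
by rewrite [peiffer x z]/peiffer mulgA h /peiffer actM !wordE.
Qed.

(** Modulo Peiffer commutators, acting by [bd x] is conjugation by [x], which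
    is invisible to the homomorphism [<y, _>] with central values. *)
Lemma peiffer_act y z x : peiffer y (pact z (bd x)) = peiffer y z.
Proof.
have -> : pact z (bd x) = x^-1 * z * x * peiffer x z by rewrite /peiffer !wordE.
rewrite peifferMr peiffer_peifferr mulg1 !peifferMr (morphV (peifferMr y)).
by rewrite -mulgA (peiffer_central y z) !wordE.
Qed.

Lemma peifferMl x y z : peiffer (x * y) z = peiffer x z * peiffer y z.
Proof.
have c := peiffer_central x z y^-1.
rewrite -(peiffer_act y z x) [peiffer y _]/peiffer !mulgA c.
by rewrite /peiffer bd_morph (gactM (pactP P)) !wordE.
Qed.

(** The two identities that turn (QM3) and (QM4) into consequences of (QM2)
    for elements [a] of trivial boundary. *)
Lemma peiffer_sym a x :
  bd a = 1 -> peiffer a x * peiffer x a = a^-1 * pact a (bd x).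
Proof. by move=> a1; rewrite /peiffer a1 (gact1 (pactP P)) !wordE. Qed.

Lemma peiffer_comm a b : bd a = 1 -> peiffer a b = [~ a, b].
Proof.
by move=> a1; rewrite /peiffer a1 (gact1 (pactP P)) /commg /conjg !wordE.
Qed.

End Nil2Peiffer.

(** C is the largest abelian quotient of M in which Peiffer commutators
    vanish. *)
Lemma qC_factor (P : preXMod) (G : groupType) (f : ptop P -> G) :
  {morph f : x y / x * y} -> (forall x y, f (peiffer x y) = 1) ->
  (forall x y, commute (f x) (f y)) ->
  forall x x', qC x = qC x' -> f x = f x'.
Proof.
move=> fM fP fC x x' e.
have f1 z : peiffers z -> f z = 1 by case=> a [b ->].
have f2 z : commutators z -> nquot_lift f (z : Mcr P) = 1.
  case=> a [b ->]; have hM := nquot_lift_morph fM f1.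
  rewrite !hM !(morphV hM); apply/eqP/commgP.
  by elim/nquot_ind: a => a; elim/nquot_ind: b => b; rewrite !nquot_liftE.
have E y : nquot_lift (nquot_lift f) (qC y) = f y.
  by rewrite /qC nquot_liftE ?nquot_liftE //; apply: nquot_lift_morph.
by rewrite -!E e.
Qed.

Definition qC_repr (P : preXMod) (c : Cgrp P) : ptop P :=
  repr (repr c : Mcr P).

Lemma qC_reprK (P : preXMod) (c : Cgrp P) : qC (qC_repr c) = c.
Proof. by rewrite /qC /qC_repr !nquot_reprK. Qed.

(** The homomorphism w : C (x) C -> M of a nil(2)-module. *)
Definition peiffer_lift (P : preXMod) : CC P -> ptop P :=
  tensor_lift (fun c d : Cgrp P => peiffer (qC_repr c) (qC_repr d)).

Section PeifferLift.
Variable P : nil2Module.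

Lemma peiffer_qC (x x' y y' : ptop P) :
  qC x = qC x' -> qC y = qC y' -> peiffer x y = peiffer x' y'.
Proof.
move=> ex ey; transitivity (peiffer x' y).
  apply: (qC_factor (f := fun z => peiffer z y)) ex => *.
  - by move=> ? ?; apply: peifferMl.
  - exact: peiffer_peifferl.
  - exact: peiffer_central.
apply: (qC_factor (f := peiffer x')) ey => *.
- by move=> ? ?; apply: peifferMr.
- exact: peiffer_peifferr.
- exact: peiffer_central.
Qed.

Let h (c d : Cgrp P) := peiffer (qC_repr c) (qC_repr d).

Let hMl a a' b : h (a * a') b = h a b * h a' b.
Proof.
by rewrite -peifferMl; apply: peiffer_qC; rewrite ?qC_morph !qC_reprK.
Qed.

Let hMr a b b' : h a (b * b') = h a b * h a b'.
Proof.
by rewrite -peifferMr; apply: peiffer_qC; rewrite ?qC_morph !qC_reprK.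
Qed.

Let hC a b a' b' : commute (h a b) (h a' b').
Proof. exact: peiffer_central. Qed.

Lemma peiffer_liftE (x y : ptop P) :
  peiffer_lift (tens (qC x) (qC y)) = peiffer x y.
Proof.
rewrite /peiffer_lift (tensor_liftE hMl hMr hC).
by apply: peiffer_qC; rewrite qC_reprK.
Qed.

Lemma peiffer_lift_morph : {morph @peiffer_lift P : s t / s * t}.
Proof. exact: (tensor_lift_morph hMl hMr hC). Qed.

Lemma bd_peiffer_lift (t : CC P) : bd (peiffer_lift t) = 1.
Proof.
apply: (CC_hom_ext (f := fun t => bd (peiffer_lift t)) (g := fun=> 1))
  => [s s'|s s'|x y].
- by rewrite peiffer_lift_morph bd_morph.
- by rewrite mulg1.
- by rewrite peiffer_liftE bd_peiffer.
Qed.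

Lemma CCact_morph (n : pbase P) :
  {morph (fun t : CC P => CCact t n) : s t / s * t}.
Proof.
have aM := gact_morph (pactP P) n.
by apply: tensor_map_morph; apply: Cmap_morph aM (@pact_peiffer P n).
Qed.

Lemma peiffer_lift_act (t : CC P) n :
  peiffer_lift (CCact t n) = pact (peiffer_lift t) n.
Proof.
apply: (CC_hom_ext (f := fun t => peiffer_lift (CCact t n))
                   (g := fun t => pact (peiffer_lift t) n)) => [s s'|s s'|x y].
- by rewrite CCact_morph peiffer_lift_morph.
- by rewrite peiffer_lift_morph (gact_morph (pactP P)).
- by rewrite CCact_tens !peiffer_liftE pact_peiffer.
Qed.

End PeifferLift.

Lemma CCmap_act (P Q : nil2Module) (f : pxm_hom P Q) (t : CC P) n :
  CCmap f (CCact t n) = CCact (CCmap f t) (mbase f n).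
Proof.
apply: (CC_hom_ext (f := fun t => CCmap f (CCact t n))
                   (g := fun t => CCact (CCmap f t) (mbase f n)))
  => [s s'|s s'|x y].
- by rewrite CCact_morph CCmap_morph.
- by rewrite CCmap_morph CCact_morph.
- by rewrite CCact_tens !CCmap_tens CCact_tens !mhom_act.
Qed.

Lemma CCmap_peiffer_lift (P Q : nil2Module) (f : pxm_hom P Q) (t : CC P) :
  mtop f (peiffer_lift t) = peiffer_lift (CCmap f t).
Proof.
apply: (CC_hom_ext (f := fun t => mtop f (peiffer_lift t))
                   (g := fun t => peiffer_lift (CCmap f t))) => [s s'|s s'|x y].
- by rewrite peiffer_lift_morph mtop_morph.
- by rewrite CCmap_morph peiffer_lift_morph.
- by rewrite CCmap_tens !peiffer_liftE mtop_peiffer.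
Qed.

Lemma delta_omega (X : quadModule) (t : CC (qbase X)) :
  delta (omega t) = peiffer_lift t.
Proof.
apply: (CC_hom_ext (f := fun t => delta (omega t)) (g := @peiffer_lift _)).
- by move=> s s'; rewrite omega_morph delta_morph.
- exact: peiffer_lift_morph.
- by move=> x y; rewrite QM2 peiffer_liftE.
Qed.

(** * The presentation of the induced quadratic module *)

(** The action is an operation of the syntax, not a function on expressions:
    this way the relations imposed below need not be closed under it by hand. *)
Inductive iexp (L C N : Type) : Type :=
| Iin (a : L)
| Iom (t : C)
| Ione
| Imul (s t : iexp L C N)
| Iinv (s : iexp L C N)
| Iact (s : iexp L C N) (n : N).
Arguments Iin {L C N} a.
Arguments Iom {L C N} t.
Arguments Ione {L C N}.

HB.instance Definition _ (L C N : Type) := gen_eqMixin (iexp L C N).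
HB.instance Definition _ (L C N : Type) := gen_choiceMixin (iexp L C N).

Fixpoint ieval (L C N : Type) (G : groupType) (act : G -> N -> G)
    (i : L -> G) (w : C -> G) (s : iexp L C N) : G :=
  match s with
  | Iin a => i a
  | Iom t => w t
  | Ione => 1
  | Imul s t => ieval act i w s * ieval act i w t
  | Iinv s => (ieval act i w s)^-1
  | Iact s n => act (ieval act i w s) n
  end.

Section Induced.
Variables (Z : quadModule) (Q : nil2Module) (v : pxm_hom (qbase Z) Q).

Local Notation E := (iexp (qL Z) (CC Q) (pbase Q)).

(** [delta] of the induced module before the relations are divided out, so that
    the relations (QM3) and (QM4) can refer to it. *)
Definition formal_delta : E -> ptop Q :=
  ieval pact (fun a => mtop v (delta a)) (@peiffer_lift Q).

(** The laws of groups with an action, then those saying that [Iin] and [Iom]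
    are equivariant homomorphisms and agree with [v] on the image of [omega],
    then (QM3) and (QM4). (QM1) and (QM2) hold by the choice of
    [formal_delta]. *)
Inductive icong : E -> E -> Prop :=
| ic_refl s : icong s s
| ic_sym s t : icong s t -> icong t s
| ic_trans s t u : icong s t -> icong t u -> icong s u
| ic_mul s s' t t' : icong s s' -> icong t t' -> icong (Imul s t) (Imul s' t')
| ic_inv s s' : icong s s' -> icong (Iinv s) (Iinv s')
| ic_act s s' n : icong s s' -> icong (Iact s n) (Iact s' n)
| ic_mulA s t u : icong (Imul s (Imul t u)) (Imul (Imul s t) u)
| ic_mul1 s : icong (Imul Ione s) s
| ic_mulr1 s : icong (Imul s Ione) s
| ic_mulV s : icong (Imul (Iinv s) s) Ione
| ic_mulrV s : icong (Imul s (Iinv s)) Ione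
| ic_act1 s : icong (Iact s 1) s
| ic_actM s m n : icong (Iact s (m * n)) (Iact (Iact s m) n)
| ic_actMl s t n : icong (Iact (Imul s t) n) (Imul (Iact s n) (Iact t n))
| ic_inM a b : icong (Iin (a * b)) (Imul (Iin a) (Iin b))
| ic_in_act a n : icong (Iin (qact a n)) (Iact (Iin a) (mbase v n))
| ic_omM s t : icong (Iom (s * t)) (Imul (Iom s) (Iom t))
| ic_om_act t n : icong (Iom (CCact t n)) (Iact (Iom t) n)
| ic_in_om t : icong (Iin (omega t)) (Iom (CCmap v t))
| ic_QM3 s x :
    icong (Iom (tens (qC (formal_delta s)) (qC x)
                * tens (qC x) (qC (formal_delta s))))
          (Imul (Iinv s) (Iact s (bd x)))
| ic_QM4 s t :
    icong (Iom (tens (qC (formal_delta s)) (qC (formal_delta t))))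
          (Imul (Iinv s) (Imul (Iinv t) (Imul s t))).

(** An N'-group with equivariant maps from [L] and [C' (x) C'] that satisfy the
    relations receives L'. It is used twice: with target M', to see that
    [delta] descends to L', and with the top group of an arbitrary quadratic
    module, for the universal property. *)
Section Soundness.
Variables (G : groupType) (act : G -> pbase Q -> G).
Variables (i : qL Z -> G) (w : CC Q -> G).
Local Notation ev := (ieval act i w).
Hypotheses (actP : group_action act) (iM : {morph i : a b / a * b})
  (wM : {morph w : s t / s * t})
  (i_act : forall a n, i (qact a n) = act (i a) (mbase v n))
  (w_act : forall t n, w (CCact t n) = act (w t) n)
  (i_om : forall t, i (omega t) = w (CCmap v t))
  (ev_QM3 : forall s x,
     w (tens (qC (formal_delta s)) (qC x) * tens (qC x) (qC (formal_delta s)))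
     = (ev s)^-1 * act (ev s) (bd x))
  (ev_QM4 : forall s t,
     w (tens (qC (formal_delta s)) (qC (formal_delta t))) = [~ ev s, ev t]).

Lemma eval_sound s t : icong s t -> ev s = ev t.
Proof.
elim=> {s t} //=.
- by move=> s t u _ -> _ ->.
- by move=> s s' t t' _ -> _ ->.
- by move=> s s' _ ->.
- by move=> s s' n _ ->.
- by move=> *; rewrite mulgA.
- by move=> *; rewrite mul1g.
- by move=> *; rewrite mulg1.
- by move=> *; rewrite mulVg.
- by move=> *; rewrite mulgV.
- by move=> *; rewrite (gact1 actP).
- by move=> *; rewrite (gactM actP).
- by move=> *; rewrite (gact_morph actP).
Qed.

End Soundness.

(** (QM1) holds for formal expressions, so [peiffer_sym] and [peiffer_comm]
    apply to all of their values in M'. *)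
Lemma bd_formal_delta s : bd (formal_delta s) = 1.
Proof.
elim: s => [a|t||s hs t ht|s hs|s hs n] /=.
- by rewrite -mhom_bd QM1 (morph1 (@mbase_morph _ _ v)).
- exact: bd_peiffer_lift.
- exact: morph1 (@bd_morph Q).
- by rewrite bd_morph hs ht mulg1.
- by rewrite (morphV (@bd_morph Q)) hs invg1.
- by rewrite bd_act hs !wordE.
Qed.

Lemma formal_delta_sound s t : icong s t -> formal_delta s = formal_delta t.
Proof.
apply: eval_sound => *.
- exact: pactP.
- by move=> a b; rewrite delta_morph mtop_morph.
- exact: peiffer_lift_morph.
- by rewrite delta_act mhom_act.
- exact: peiffer_lift_act.
- by rewrite delta_omega CCmap_peiffer_lift.
- by rewrite peiffer_lift_morph !peiffer_liftE peiffer_sym ?bd_formal_delta.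
- by rewrite peiffer_liftE peiffer_comm ?bd_formal_delta.
Qed.

Definition irel : rel E := fun s t => `[< icong s t >].

Lemma irel_equiv : equiv_class_of irel.
Proof.
split=> [s|s t|t s u].
- by apply/asboolP; apply: ic_refl.
- by apply: asbool_equiv_eq; split; apply: ic_sym.
- by move=> /asboolP st /asboolP tu; apply/asboolP; apply: ic_trans st tu.
Qed.

Canonical irel_eqrel := EquivRelPack irel_equiv.

Definition induced : Type := {eq_quot irel_eqrel}.
HB.instance Definition _ := Choice.on induced.
HB.instance Definition _ := EqQuotient.on induced.

Definition ipi (s : E) : induced := \pi_induced s.

Lemma ipiP s t : ipi s = ipi t <-> icong s t.
Proof.
split=> [/eqquotP|h]; first by move/asboolP.
by apply/eqquotP/asboolP.
Qed.

Lemma ireprK (c : induced) : ipi (repr c) = c.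
Proof. exact: reprK. Qed.

Lemma icong_repr s : icong (repr (ipi s)) s.
Proof. by apply/ipiP; rewrite ireprK. Qed.

Lemma ipi_ind (K : induced -> Prop) : (forall s, K (ipi s)) -> forall c, K c.
Proof. by move=> h c; rewrite -(ireprK c). Qed.

Definition imul (c d : induced) : induced := ipi (Imul (repr c) (repr d)).
Definition iinv (c : induced) : induced := ipi (Iinv (repr c)).
Definition iact (c : induced) (n : pbase Q) : induced := ipi (Iact (repr c) n).

Lemma ipi_mul s t : ipi (Imul s t) = imul (ipi s) (ipi t).
Proof. by apply/ipiP/ic_mul; apply/ic_sym/icong_repr. Qed.

Lemma ipi_inv s : ipi (Iinv s) = iinv (ipi s).
Proof. by apply/ipiP/ic_inv/ic_sym/icong_repr. Qed.

Lemma ipi_act s n : ipi (Iact s n) = iact (ipi s) n.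
Proof. by apply/ipiP/ic_act/ic_sym/icong_repr. Qed.

Fact imulA : associative imul.
Proof.
elim/ipi_ind=> s; elim/ipi_ind=> t; elim/ipi_ind=> u.
by rewrite -!ipi_mul; apply/ipiP/ic_mulA.
Qed.
Fact imul1 : left_id (ipi Ione) imul.
Proof. by elim/ipi_ind=> s; rewrite -ipi_mul; apply/ipiP/ic_mul1. Qed.
Fact imulr1 : right_id (ipi Ione) imul.
Proof. by elim/ipi_ind=> s; rewrite -ipi_mul; apply/ipiP/ic_mulr1. Qed.
Fact imulV : left_inverse (ipi Ione) iinv imul.
Proof. by elim/ipi_ind=> s; rewrite -ipi_inv -ipi_mul; apply/ipiP/ic_mulV. Qed.
Fact imulrV : right_inverse (ipi Ione) iinv imul.
Proof. by elim/ipi_ind=> s; rewrite -ipi_inv -ipi_mul; apply/ipiP/ic_mulrV. Qed.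

HB.instance Definition _ := isGroup.Build induced
  imulA imul1 imulr1 imulV imulrV.

Lemma ipiM s t : ipi (Imul s t) = ipi s * ipi t.
Proof. exact: ipi_mul. Qed.

Lemma ipiV s : ipi (Iinv s) = (ipi s)^-1.
Proof. exact: ipi_inv. Qed.

Lemma iactP : group_action iact.
Proof.
split.
- by elim/ipi_ind=> s; rewrite -ipi_act; apply/ipiP/ic_act1.
- by elim/ipi_ind=> s m n; rewrite -!ipi_act; apply/ipiP/ic_actM.
- move=> n; elim/ipi_ind=> s; elim/ipi_ind=> t.
  by rewrite -ipiM -!ipi_act -ipiM; apply/ipiP/ic_actMl.
Qed.

Definition iomega (t : CC Q) : induced := ipi (Iom t).
Definition idelta (c : induced) : ptop Q := formal_delta (repr c).

Lemma ideltaE s : idelta (ipi s) = formal_delta s.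
Proof. exact/formal_delta_sound/icong_repr. Qed.

Definition induced_quad : quadModule.
Proof.
exists Q induced iact iomega idelta.
- exact: iactP.
- by move=> s t; rewrite /iomega -ipiM; apply/ipiP/ic_omM.
- by elim/ipi_ind=> s; elim/ipi_ind=> t; rewrite -ipiM !ideltaE.
- by move=> t n; rewrite /iomega -ipi_act; apply/ipiP/ic_om_act.
- by elim/ipi_ind=> s n; rewrite -ipi_act !ideltaE.
- by elim/ipi_ind=> s; rewrite ideltaE bd_formal_delta.
- by move=> x y; rewrite ideltaE; apply: peiffer_liftE.
- elim/ipi_ind=> s x; rewrite !ideltaE -ipi_act -ipiV -ipiM.
  exact/ipiP/ic_QM3.
- elim/ipi_ind=> s; elim/ipi_ind=> t; rewrite !ideltaE /commg /conjg.
  by rewrite -!ipiV -(ipiM s t) -(ipiM (Iinv t)) -ipiM; apply/ipiP/ic_QM4.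
Defined.

Definition induced_unit : quad_hom Z induced_quad.
Proof.
exists v (fun a => ipi (Iin a)) => /=.
- by move=> a b; rewrite -ipiM; apply/ipiP/ic_inM.
- by move=> a n; rewrite -ipi_act; apply/ipiP/ic_in_act.
- by move=> t; apply/ipiP/ic_in_om.
- by move=> a; rewrite ideltaE.
Defined.

(** * The universal property *)

Section Universal.
Variables (W : quadModule) (u : pxm_hom Q (qbase W)) (theta : quad_hom Z W).
Hypothesis theta_over : qhom_base theta = pxm_comp u v.

Local Notation ev := (ieval (fun b n => qact b (mbase u n)) (qhom_L theta)
  (fun t => omega (CCmap u t))).

(** Identifies the arguments of [omega] in the relations (QM3) and (QM4) of L',
    once they are moved to W, with those in the axioms of W. *)
Lemma delta_ieval s : delta (ev s) = mtop u (formal_delta s).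
Proof.
elim: s => [a|t||s hs t ht|s hs|s hs n] /=.
- by rewrite qhom_delta theta_over.
- by rewrite delta_omega CCmap_peiffer_lift.
- by rewrite !morph1 //; [exact: mtop_morph | exact: delta_morph].
- by rewrite delta_morph hs ht mtop_morph.
- by rewrite (morphV (@delta_morph W)) hs (morphV (@mtop_morph _ _ u)).
- by rewrite delta_act hs mhom_act.
Qed.

Lemma desc_sound s t : icong s t -> ev s = ev t.
Proof.
apply: eval_sound => *.
- split=> [b|b m n|n b c].
  + by rewrite (morph1 (@mbase_morph _ _ u)) (gact1 (qactP W)).
  + by rewrite mbase_morph (gactM (qactP W)).
  + by rewrite (gact_morph (qactP W)).
- exact: qhom_L_morph.
- by move=> ? ?; rewrite CCmap_morph omega_morph.
- by rewrite qhom_L_act theta_over.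
- by rewrite CCmap_act omega_act.
- by rewrite qhom_omega theta_over CCmap_comp.
- by rewrite CCmap_morph !CCmap_tens -!delta_ieval QM3 mhom_bd.
- by rewrite CCmap_tens -!delta_ieval QM4.
Qed.

Let descE s : ev (repr (ipi s)) = ev s.
Proof. exact/desc_sound/icong_repr. Qed.

Definition induced_desc : quad_hom induced_quad W.
Proof.
exists u (fun c : induced => ev (repr c)) => /=.
- by elim/ipi_ind=> s; elim/ipi_ind=> t; rewrite -ipiM !descE.
- by elim/ipi_ind=> s n; rewrite -ipi_act !descE.
- by move=> t; rewrite descE.
- by elim/ipi_ind=> s; rewrite ideltaE descE delta_ieval.
Defined.

Lemma induced_desc_unit : theta = quad_comp induced_desc induced_unit.
Proof.
apply: quad_hom_eq; first exact: theta_over.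
by apply/funext=> a /=; rewrite descE.
Qed.

Lemma induced_desc_unique (phi : quad_hom induced_quad W) :
  qhom_base phi = u -> theta = quad_comp phi induced_unit -> induced_desc = phi.
Proof.
move=> phi_u phiE; apply: quad_hom_eq; first exact: esym.
apply/funext; elim/ipi_ind=> s /=; rewrite descE.
have phiM := @qhom_L_morph _ _ phi.
elim: s => [a|t||s hs t ht|s hs|s hs n] /=.
- by rewrite phiE.
- by rewrite -phi_u -(qhom_omega phi).
- by rewrite -(morph1 phiM).
- by rewrite hs ht ipiM phiM.
- by rewrite hs ipiV (morphV phiM).
- by rewrite hs ipi_act -phi_u -(qhom_L_act phi).
Qed.

End Universal.
End Induced.

Theorem proposition4p1 : cofibration forget_Quad.
Proof.
move=> K J v Z eK; case: K / eK v => v.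
exists (induced_quad v), (induced_unit v); split; first by exists erefl, erefl.
move=> W u theta theta_over; exists (induced_desc theta_over); split.
  by split; last exact: induced_desc_unit.
by move=> phi [phi_u phiE]; apply: induced_desc_unique.
Qed.
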